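(* Consider the repeated newsvendor with horizon $T$, order quantities $X_t\in[0,B]$, and loss $\ell(x,d)=h(x-d)_++b(d-x)_+$ with $h,b>0$. A demand law $\mathbb{P}$ on $[0,B]$ is drawn from a prior $\xi$, and conditionally on $\mathbb{P}$ the demands $D_1,\dots,D_T$ are i.i.d. with law $\mathbb{P}$ (so $D_t\in[0,B]$ a.s.). After choosing $X_t$ the learner observes only $O_t=(\min\{D_t,X_t\},\mathbf{1}\{D_t\le X_t\})$; $H_t=((X_s,O_s))_{s\le t}$. Let $f_{\mathbb{P}}(x)=\mathbb{E}_{\mathbb{P}}[\ell(x,D)]$, $x^\star_{\mathbb{P}}\in\arg\min_{x\in[0,B]}f_{\mathbb{P}}(x)$, and for a policy $\pi$ let $\mathrm{BReg}_T(\pi)=\mathbb{E}[\sum_{t=1}^T(f_{\mathbb{P}}(X_t)-f_{\mathbb{P}}(x^\star_{\mathbb{P}}))]$, the expectation being over $\mathbb{P}\sim\xi$ and all randomness of the interaction. Let $\pi_\star$ be Thompson sampling: at each round $t$ it draws $\widetilde{\mathbb{P}}_t\sim\xi(\cdot\mid H_{t-1})$ (the posterior) and plays $X_t\in\arg\min_{x\in[0,B]}f_{\widetilde{\mathbb{P}}_t}(x)$. Then $\mathrm{BReg}_T(\pi_\star)\le\widetilde O(\sqrt{T})$, where $\widetilde O(\cdot)$ hides polylogarithmic factors in $T$ and constants depending on $B,h,b$.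
   Context: $(a)_+=\max\{a,0\}$. *)

(* Defs.v *)
From HB Require Import structures.
From mathcomp Require Import all_boot all_order all_algebra.
From mathcomp Require Import all_classical all_reals all_analysis.
Set Implicit Arguments. Unset Strict Implicit. Unset Printing Implicit Defensive.
Import Order.TTheory GRing.Theory Num.Theory.
Import numFieldNormedType.Exports.
Local Open Scope classical_set_scope.
Local Open Scope ring_scope.

Section Newsvendor.
Context (R : realType) (B h b : R).

Definition nv_loss (x d : R) : R := h * Num.max (x - d) 0 + b * Num.max (d - x) 0.

Definition nv_f (P : {measure set R -> \bar R}) (x : R) : \bar R :=
  (\int[P]_(d in [set: R]) (nv_loss x d)%:E)%E.

(* optimal value f_P(x*_P) = min_{x in [0,B]} f_P(x) (the min is attained) *)
Definition nv_opt (P : {measure set R -> \bar R}) : \bar R :=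
  ereal_inf [set nv_f P x | x in `[0, B]].

Definition argmin_selection d (Theta : measurableType d)
    (Q : R.-pker Theta ~> R) (g : Theta -> R) : Prop :=
  [/\ measurable_fun [set: Theta] g,
      forall th, g th \in `[0, B] &
      forall th x, x \in `[0, B] -> (nv_f (Q th) (g th) <= nv_f (Q th) x)%E].

Context d (Theta : measurableType d) (mu : probability Theta R)
  (Q : R.-pker Theta ~> R) (g : Theta -> R)
  d' (Omega : measurableType d') (P : probability Omega R) (T : nat)
  (theta : Omega -> Theta) (D : nat -> Omega -> R)
  (thetat : nat -> Omega -> Theta) (kappa : nat -> Omega -> probability Theta R).

Definition nv_X (t : nat) (w : Omega) : R := g (thetat t w).

Definition hist_gen (t : nat) : set (set Omega) :=
  [set E | exists s, (s < t)%N /\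
     ((exists A : set R, measurable A /\
        (E = nv_X s @^-1` A \/ E = (fun w => Num.min (D s w) (nv_X s w)) @^-1` A))
      \/ E = [set w | D s w <= nv_X s w])].

Definition past_gen (t : nat) : set (set Omega) :=
  [set E | (exists A : set Theta, measurable A /\ E = theta @^-1` A)
        \/ (exists s (A : set R), (s < T)%N /\ measurable A /\ E = D s @^-1` A)
        \/ (exists s (A : set Theta), (s < t)%N /\ measurable A /\
              E = thetat s @^-1` A)].

(* The run of Thompson sampling on horizon T (rounds t = 0,...,T-1):
   - theta ~ mu (the demand law is Q theta) and, given theta, D_0..D_{T-1}
     are i.i.d. with law Q theta;
   - kappa t is (a version of) the posterior of theta given H_{t-1}
     (sigma(H_{t-1})-measurable and satisfying the defining identity);
   - conditionally on (theta, D, theta~_0..theta~_{t-1}) the sample theta~_t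
     has law kappa t, i.e. theta~_t is a fresh draw from the posterior. *)
Definition thompson_sampling_run : Prop :=
  [/\ measurable_fun [set: Omega] theta,
      (forall t, measurable_fun [set: Omega] (D t)),
      (forall t, measurable_fun [set: Omega] (thetat t)),
      (forall (A : set Theta) (E : 'I_T -> set R), measurable A ->
         (forall i, measurable (E i)) ->
         P [set w | A (theta w) /\ forall i : 'I_T, E i (D i w)] =
         (\int[mu]_(x in A) \prod_(i < T) Q x (E i))%E) &
      (forall t, (t < T)%N -> forall A : set Theta, measurable A ->
         [/\ (forall r : R,
                <<s hist_gen t >> [set w | (kappa t w A <= r%:E)%E]),
             (forall G, <<s hist_gen t >> G ->
                P (theta @^-1` A `&` G) = (\int[P]_(w in G) kappa t w A)%E) &
             (forall G, <<s past_gen t >> G ->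
                P (thetat t @^-1` A `&` G) = (\int[P]_(w in G) kappa t w A)%E)])].

Definition bayes_regret : \bar R :=
  (\int[P]_(w in [set: Omega])
     \sum_(t < T) (nv_f (Q (theta w)) (nv_X t w) - nv_opt (Q (theta w))))%E.

End Newsvendor.

(* Main.v *)
Require Import Defs.
From HB Require Import structures.
From mathcomp Require Import all_boot all_order all_algebra.
From mathcomp Require Import all_classical all_reals all_analysis.
From mathcomp Require Import measurable_realfun ring lra.
Set Implicit Arguments. Unset Strict Implicit. Unset Printing Implicit Defensive.
Import Order.TTheory GRing.Theory Num.Theory.
Local Open Scope classical_set_scope.
Local Open Scope ring_scope.

(** Since [nv_loss x d = b d + h x - (h + b) min(d, x)] and
    [min(d, x) = int_0^B 1{y < x} 1{y < d} dy], the regret is an average over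
    levels [y] of [(1{y < X*} - 1{y < X_t}) S(y)], where [S(y)] is the
    probability that the demand exceeds [y].  The integral over [y] is replaced
    by a Riemann sum with [T] nodes.

    Fix a level [y].  The rounds with [y < X_s] reveal whether [y < D_s]; let
    [N_t] be their number before round [t], [Z_t] the number of those with
    [y < D_s], and [M_t = Z_t - S(y) (N_t + 1)].  Given the history, [X*] and
    [X_t] have the same law, so [S(y)] may be replaced by the error
    [-M_t / (N_t + 1)] of the estimator [Z_t / (N_t + 1)], and by Young's
    inequality the level-[y] regret of round [t] is at most
    [sqrt T * E[1{y < X_t} / (N_t + 1)] + E[M_t^2 / (N_t + 1)] / sqrt T].
    Equality in law is used once more here, to trade [1{y < X*}] for
    [1{y < X_t}] in front of [1 / (N_t + 1)].  Finally
    [sum_t 1{y < X_t} / (N_t + 1) <= 2 ln (T + 1)] pathwise, and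
    [M_t^2 / (N_t + 1)] grows in mean by at most [E[1{y < X_t} / (N_t + 1)]] per
    round because the increments of [M_t] are centred.  No concentration
    inequality is needed. *)

Local Notation "1{ p }" := ((p%R : bool)%:R).

(** * Riemann sums of threshold indicators *)

Section grid.
Context (R : realFieldType).

(** The sum is [delta] times the number of nodes below [a], that is, [a] rounded up to a multiple of
    [delta]. *)
Lemma grid_sum_approx (delta a : R) (K : nat) : 0 < delta -> 0 <= a ->
  a <= K%:R * delta ->
  `|\sum_(k < K) delta * 1{k%:R * delta < a} - a| <= delta.
Proof.
move=> d0 a0 aK.
(* The induction on [K] cannot assume that the grid covers [a], so the lower bound is truncated at
   [K%:R * delta]. The first bound feeds the second: a node below [a] is added only to a sum that is
   itself below [a]. *)
suff [H1 [H2 H3]] : \sum_(k < K) delta * 1{k%:R * delta < a} <= K%:R * delta /\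
    \sum_(k < K) delta * 1{k%:R * delta < a} <= a + delta /\
    Num.min a (K%:R * delta) <= \sum_(k < K) delta * 1{k%:R * delta < a}.
  rewrite (min_idPl aK) in H3; rewrite ler_norml; lra.
elim: K {aK} => [|K [I1 [I2 I3]]].
  by rewrite big_ord0 mul0r ge_min lexx orbT; split => //; split => //; lra.
rewrite !big_ord_recr /= -[K.+1]addn1 natrD mulrDl mul1r.
set s := \sum_(_ < _) _ in I1 I2 I3 *; set c := K%:R * delta in I1 I2 I3 *.
have -> : Num.min a (c + delta) = if a < c + delta then a else c + delta by [].
move: I3; have -> : Num.min a c = if a < c then a else c by [].
by case: (ltP c a); case: (ltP a (c + delta)); case: (ltP a c);
  rewrite ?mulr1n ?mulr0n ?mulr1 ?mulr0 => *; repeat split; lra.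
Qed.

End grid.

(** * Bounded measurable functions and their expectations *)

Section bounded_measurable.
Context d (T : measurableType d) (R : realType).
Implicit Types f g : T -> R.

(** This class is closed under the ring operations and integrable for every finite measure, so
    expectations can be handled as real numbers. *)
Definition bmeas f := measurable_fun [set: T] f /\ exists c, forall x, `|f x| <= c.

Lemma bmeas_measurable f : bmeas f -> measurable_fun [set: T] f.
Proof. by case. Qed.

Lemma bmeas_cst (r : R) : bmeas (fun=> r).
Proof. by split; [exact: measurable_cst|exists `|r|]. Qed.

Lemma bmeasD f g : bmeas f -> bmeas g -> bmeas (fun x => f x + g x).
Proof.
move=> [mf [c fc]] [mg [e ge]]; split; first exact: measurable_funD.
by exists (c + e) => x; rewrite (le_trans (ler_normD _ _))// lerD.
Qed.

Lemma bmeasM f g : bmeas f -> bmeas g -> bmeas (fun x => f x * g x).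
Proof.
move=> [mf [c fc]] [mg [e ge]]; split; first exact: measurable_funM.
by exists (c * e) => x; rewrite normrM ler_pM.
Qed.

Lemma bmeasZ (r : R) f : bmeas f -> bmeas (fun x => r * f x).
Proof. exact/bmeasM/bmeas_cst. Qed.

Lemma bmeasN f : bmeas f -> bmeas (fun x => - f x).
Proof.
move=> [mf [c fc]]; split; first exact: measurableT_comp.
by exists c => x; rewrite normrN.
Qed.

Lemma bmeasB f g : bmeas f -> bmeas g -> bmeas (fun x => f x - g x).
Proof. by move=> bf bg; apply: bmeasD bf (bmeasN bg). Qed.

Lemma bmeas_sum (n : nat) (F : nat -> T -> R) :
  (forall i, (i < n)%N -> bmeas (F i)) -> bmeas (fun x => \sum_(i < n) F i x).
Proof.
elim: n => [_|n IH bF].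
  by under eq_fun do rewrite big_ord0; exact: bmeas_cst.
under eq_fun do rewrite big_ord_recr/=.
by apply: bmeasD; [apply: IH => i ?; exact/bF/ltnW|exact: bF].
Qed.

Lemma bmeas_bool (p : T -> bool) : measurable [set x | p x] ->
  bmeas (fun x => 1{p x}).
Proof.
move=> mp; split; last first.
  by exists 1 => x; case: (p x); rewrite /= ?normr1 ?normr0.
rewrite (_ : (fun _ => _) = \1_[set x | p x]); first exact: measurable_indic.
apply/funext => x; rewrite indicE; case: (boolP (p x)) => px.
  by rewrite mem_set.
by rewrite memNset//; exact/negP.
Qed.

Lemma bmeas_ltr f g : measurable_fun [set: T] f -> measurable_fun [set: T] g ->
  bmeas (fun x => 1{f x < g x}).
Proof.
move=> mf mg; apply: bmeas_bool.
have := measurable_fun_ltr mf mg => /(_ measurableT [set true]).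
by rewrite setTI; apply.
Qed.

Lemma bmeas_indic (A : set T) : measurable A -> bmeas (\1_A).
Proof.
move=> mA; split; first exact: measurable_indic.
by exists 1 => x; rewrite indicE; case: (_ \in _); rewrite /= ?normr1 ?normr0.
Qed.

Lemma bmeasV1 f : (forall x, 0 <= f x) -> measurable_fun [set: T] f ->
  bmeas (fun x => (f x + 1)^-1).
Proof.
move=> f0 mf; split; last first.
  exists 1 => x; have := f0 x => fx; rewrite ger0_norm ?invr_ge0 ?addr_ge0//.
  by rewrite invf_le1 ?ltr_wpDl// lerDr.
have mf1 : measurable_fun [set: T] (fun x => f x + 1) by exact: measurable_funD.
rewrite (_ : (fun _ => _) = (fun x => (f x + 1) `^ (-1))); last first.
  by apply/funext => x; rewrite powR_inv1// addr_ge0.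
exact: measurableT_comp (measurable_powR _) mf1.
Qed.

Variable mu : {finite_measure set T -> \bar R}.

Lemma bmeas_integrable f : bmeas f -> mu.-integrable [set: T] (EFin \o f).
Proof.
move=> [mf [c fc]].
apply: (@le_integrable _ _ _ _ _ measurableT _ (EFin \o cst c)).
- exact/measurable_EFinP.
- by move=> x _ /=; rewrite !lee_fin (le_trans (fc x))// ler_norm.
- exact: finite_measure_integrable_cst.
Qed.

Local Notation "''E' f" := (Rintegral mu [set: T] f) (at level 10, f at level 8).

Lemma bmeas_integralE f : bmeas f -> (\int[mu]_x (f x)%:E = ('E f)%:E)%E.
Proof. by move=> bf; rewrite fineK//; apply: integrable_fin_num => //; exact: bmeas_integrable. Qed.

Lemma expect_add f g : bmeas f -> bmeas g -> 'E (fun x => f x + g x) = 'E f + 'E g.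
Proof. by move=> bf bg; rewrite RintegralD//; exact: bmeas_integrable. Qed.

Lemma expect_sub f g : bmeas f -> bmeas g -> 'E (fun x => f x - g x) = 'E f - 'E g.
Proof. by move=> bf bg; rewrite RintegralB//; exact: bmeas_integrable. Qed.

Lemma expect_scale r f : bmeas f -> 'E (fun x => r * f x) = r * 'E f.
Proof. by move=> bf; rewrite RintegralZl//; exact: bmeas_integrable. Qed.

Lemma expect_le f g : bmeas f -> bmeas g -> (forall x, f x <= g x) -> 'E f <= 'E g.
Proof. by move=> bf bg fg; apply: le_Rintegral => //; exact: bmeas_integrable. Qed.

Lemma expect_sum (n : nat) (F : nat -> T -> R) :
  (forall i, (i < n)%N -> bmeas (F i)) ->
  'E (fun x => \sum_(i < n) F i x) = \sum_(i < n) 'E (F i).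
Proof.
elim: n => [_|n IH bF].
  rewrite big_ord0; under eq_Rintegral do rewrite big_ord0.
  by rewrite Rintegral_cst// mul0r.
under eq_Rintegral do rewrite big_ord_recr/=.
rewrite expect_add ?big_ord_recr/= ?IH//; last exact: bF.
- by move=> i ?; exact/bF/ltnW.
- by apply: bmeas_sum => i ?; exact/bF/ltnW.
Qed.

Lemma expect_dist f g (r : R) : bmeas f -> bmeas g -> (forall x, `|f x - g x| <= r) ->
  `|'E f - 'E g| <= r * fine (mu [set: T]).
Proof.
move=> bf bg fg; rewrite -Rintegral_cst// -expect_sub//.
apply: le_trans (le_normr_Rintegral _ (bmeas_integrable (bmeasB bf bg))) _ => //.
apply: expect_le => //; last exact: bmeas_cst.
have [mfg [c fc]] := bmeasB bf bg.
by split; [exact: measurableT_comp|exists c => x; rewrite normr_id].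
Qed.

End bounded_measurable.

(** * Passing from indicators to bounded functions *)

Section transfer.
Context (R : realType).

Lemma indicb d (T : measurableType d) (p : T -> bool) x :
  \1_[set z | p z] x = 1{p x} :> R.
Proof.
rewrite indicE; case: (boolP (p x)) => px; first by rewrite mem_set.
by rewrite memNset//; exact/negP.
Qed.

Lemma bmeas_comp d (T : measurableType d) d' (Z : measurableType d')
    (phi : T -> Z) (W : Z -> R) :
  measurable_fun [set: T] phi -> bmeas W -> bmeas (fun x => W (phi x)).
Proof.
move=> mphi [mW [c Wc]]; split; first exact: measurableT_comp.
by exists c.
Qed.

(** [W + c] takes values in [[0, 2c]], so [K] superlevel sets spaced by [2 * c / K%:R] approximate
    it uniformly within one step. Multiplying by [U] and integrating preserves the error up to the
    factors [u] and the total mass. *)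
Lemma expect_layer d (T : measurableType d) d' (Z : measurableType d')
    (mu : {finite_measure set T -> \bar R}) (phi : T -> Z) (U : T -> R)
    (W : Z -> R) (c u : R) (K : nat) : (0 < K)%N -> 0 < c ->
  measurable_fun [set: T] phi -> bmeas U -> (forall x, `|U x| <= u) ->
  measurable_fun [set: Z] W -> (forall z, `|W z| <= c) ->
  forall delta, delta = 2 * c / K%:R ->
  `|Rintegral mu [set: T] (fun x => W (phi x) * U x) -
    (\sum_(k < K) delta * Rintegral mu [set: T]
        (fun x => \1_[set z | k%:R * delta < W z + c] (phi x) * U x)
     - c * Rintegral mu [set: T] U)| <= delta * u * fine (mu [set: T]).
Proof.
move=> K0 c0 mphi bU Uu mW Wc delta dE.
have d0 : 0 < delta by rewrite dE divr_gt0 ?ltr0n ?mulr_gt0.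
have bW : bmeas W by split => //; exists c.
have mA k : measurable [set z | k%:R * delta < W z + c].
  have mWc : measurable_fun [set: Z] (fun z => W z + c) by exact: measurable_funD.
  have := @measurable_fun_ltr _ _ _ _ (cst (k%:R * delta)) _ (measurable_cst _) mWc.
  by move=> /(_ measurableT [set true]); rewrite setTI; apply.
have b1 k : bmeas (fun x => \1_[set z | k%:R * delta < W z + c] (phi x) * U x).
  by apply: bmeasM => //; apply: bmeas_comp mphi _; exact: bmeas_indic.
rewrite -expect_scale//.
under eq_bigr do rewrite -expect_scale//.
pose F (k : nat) x := delta * (\1_[set z | k%:R * delta < W z + c] (phi x) * U x).
rewrite -(expect_sum _ (F := F)); last first.
  by move=> i _; exact: bmeasZ.
rewrite -expect_sub; last 2 first.
- by apply: (bmeas_sum (F := F)) => i _; exact: bmeasZ.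
- exact: bmeasZ.
apply: expect_dist.
- by apply: bmeasM => //; exact: bmeas_comp.
- by apply: bmeasB; [apply: (bmeas_sum (F := F)) => i _|]; exact: bmeasZ.
- move=> x; rewrite /F /=.
  under eq_bigr do rewrite mulrA.
  rewrite -mulr_suml -!mulrBl normrM; apply: ler_pM => //.
  under eq_bigr do rewrite indicb.
  rewrite distrC -addrA -opprD addrC.
  have := Wc (phi x); rewrite ler_norml => /andP[Wl Wr].
  rewrite addrC [c + _]addrC; apply: grid_sum_approx => //; first lra.
  rewrite dE mulrC mulfVK; last by rewrite pnatr_eq0 -lt0n.
  lra.
Qed.

Lemma eq_of_le_inv (x y C : R) :
  (forall K, (0 < K)%N -> `|x - y| <= C / K%:R :> R) -> x = y.
Proof.
move=> H; apply/eqP; rewrite -subr_eq0 -normr_le0 leNgt; apply/negP => n0.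
have C0 : 0 <= C by have := H 1 isT; rewrite divr1; exact: le_trans.
set K := (Num.Def.archi_bound (C / `|x - y|)).+1.
have := H K isT; rewrite ler_pdivlMr ?ltr0n// mulrC -ler_pdivlMr// leNgt.
rewrite (lt_trans (archi_boundP (divr_ge0 C0 (ltW n0))))//.
by rewrite ltr_nat.
Qed.

(* Extends an identity from indicators to bounded functions [W] by uniformly
   approximating [W] with a grid of its superlevel sets. *)
Lemma expect_transfer d1 (T1 : measurableType d1) d2 (T2 : measurableType d2)
    d (Z : measurableType d) (mu1 : {finite_measure set T1 -> \bar R})
    (mu2 : {finite_measure set T2 -> \bar R})
    (phi1 : T1 -> Z) (phi2 : T2 -> Z) (U1 : T1 -> R) (U2 : T2 -> R) (W : Z -> R) :
  measurable_fun [set: T1] phi1 -> measurable_fun [set: T2] phi2 ->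
  bmeas U1 -> bmeas U2 ->
  (forall A, measurable A ->
    Rintegral mu1 [set: T1] (fun x => \1_A (phi1 x) * U1 x) =
    Rintegral mu2 [set: T2] (fun x => \1_A (phi2 x) * U2 x)) ->
  bmeas W ->
  Rintegral mu1 [set: T1] (fun x => W (phi1 x) * U1 x) =
  Rintegral mu2 [set: T2] (fun x => W (phi2 x) * U2 x).
Proof.
move=> mphi1 mphi2 bU1 bU2 H [mW [c0 Wc0]].
(* The added 1 makes the bound strictly positive, as the grid step must be. *)
pose c := `|c0| + 1; have c_gt0 : 0 < c by rewrite ltr_wpDl.
have Wc z : `|W z| <= c by rewrite (le_trans (Wc0 z))// ler_wpDr// ler_norm.
have [mU1 [u1 Uu1]] := bU1; have [mU2 [u2 Uu2]] := bU2.
have HT : Rintegral mu1 [set: T1] U1 = Rintegral mu2 [set: T2] U2.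
  have := H _ measurableT; under eq_Rintegral do rewrite indicT mul1r.
  by move=> ->; apply: eq_Rintegral => x _; rewrite indicT mul1r.
apply: (@eq_of_le_inv _ _ (2 * c * (u1 * fine (mu1 setT) + u2 * fine (mu2 setT)))).
move=> K K0.
have := expect_layer mu1 K0 c_gt0 mphi1 bU1 Uu1 mW Wc erefl.
have := expect_layer mu2 K0 c_gt0 mphi2 bU2 Uu2 mW Wc erefl.
rewrite -HT; set delta := 2 * c / K%:R.
(* The hypothesis on indicators identifies the two Riemann sums term by term, so both expectations
   lie within a multiple of [1 / K] of the same number. *)
have -> : \sum_(k < K) delta * Rintegral mu2 [set: T2]
    (fun x => \1_[set z | k%:R * delta < W z + c] (phi2 x) * U2 x) =
  \sum_(k < K) delta * Rintegral mu1 [set: T1]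
    (fun x => \1_[set z | k%:R * delta < W z + c] (phi1 x) * U1 x).
  apply: eq_bigr => k _; rewrite H//.
  have mWc : measurable_fun [set: Z] (fun z => W z + c) by exact: measurable_funD.
  have := @measurable_fun_ltr _ _ _ _ (cst (k%:R * delta)) _ (measurable_cst _) mWc.
  by move=> /(_ measurableT [set true]); rewrite setTI; apply.
set S := (\sum_(k < K) _ - _).
have -> : 2 * c * (u1 * fine (mu1 setT) + u2 * fine (mu2 setT)) / K%:R =
    delta * u1 * fine (mu1 setT) + delta * u2 * fine (mu2 setT).
  by rewrite /delta; ring.
by rewrite !ler_norml => /andP[? ?] /andP[? ?]; apply/andP; split; lra.
Qed.

End transfer.

(** * Weighted integrals agreeing on a pi-system *)

Section pi_system.
Context (R : realType) d (T : measurableType d) (mu : {finite_measure set T -> \bar R}).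

Lemma bmeas_indicM (A : set T) (U : T -> R) :
  measurable A -> bmeas U -> bmeas (fun x => \1_A x * U x).
Proof. by move=> mA bU; apply: bmeasM => //; exact: bmeas_indic. Qed.

Lemma expect_indic_integral (A : set T) (U : T -> R) : measurable A -> bmeas U ->
  (Rintegral mu [set: T] (fun x => \1_A x * U x))%:E =
  (\int[mu]_(x in A) (U x)%:E)%E.
Proof.
move=> mA bU; rewrite -bmeas_integralE; last exact: bmeas_indicM.
rewrite [RHS]integral_mkcond; apply: eq_integral => x _.
rewrite /patch indicE; case: ifPn => _; first by rewrite mul1r.
by rewrite mul0r.
Qed.

(** The sets on which the two weighted integrals agree form a Dynkin system: complements use the
    equality of the total integrals, and disjoint unions use countable additivity for nonnegative
    weights. *)
Lemma expect_pi_system (G : set (set T)) (U V : T -> R) :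
  setI_closed G -> G `<=` measurable ->
  bmeas U -> bmeas V -> (forall x, 0 <= U x) -> (forall x, 0 <= V x) ->
  Rintegral mu [set: T] U = Rintegral mu [set: T] V ->
  (forall A, G A -> Rintegral mu [set: T] (fun x => \1_A x * U x) =
                    Rintegral mu [set: T] (fun x => \1_A x * V x)) ->
  forall A, <<s G >> A -> Rintegral mu [set: T] (fun x => \1_A x * U x) =
                    Rintegral mu [set: T] (fun x => \1_A x * V x).
Proof.
move=> GI Gm bU bV U0 V0 UV UVG.
have sG : <<s G >> `<=` measurable.
  by apply: smallest_sub => //; exact: sigma_algebra_measurable.
have E1 (A : set T) (W : T -> R) : measurable A -> bmeas W ->
    Rintegral mu [set: T] (fun x => \1_(~` A) x * W x) =
    Rintegral mu [set: T] W - Rintegral mu [set: T] (fun x => \1_A x * W x).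
  move=> mA bW; rewrite -expect_sub//; last exact: bmeas_indicM.
  by apply: eq_Rintegral => x _; rewrite !indicE in_setC; case: (_ \in _) => /=; ring.
apply: (@dynkin_induction _ (g_sigma_algebraType G) G) => //=.
- under eq_Rintegral do rewrite indicT mul1r.
  by rewrite UV; apply: eq_Rintegral => x _; rewrite indicT mul1r.
- move=> S mS US; have mS' : d.-measurable S := sG _ mS.
  by rewrite !E1// UV US.
- move=> F mF tF UF.
  have mF' k : d.-measurable (F k) := sG _ (mF k).
  apply: EFin_inj; rewrite !expect_indic_integral//; last 2 first.
  + exact: bigcup_measurable.
  + exact: bigcup_measurable.
  rewrite !ge0_integral_bigcup//.
  + by apply: eq_eseriesr => k _; rewrite -!expect_indic_integral// UF.
  + by apply: measurable_funTS; apply/measurable_EFinP; exact: bmeas_measurable.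
  + by move=> x _; rewrite lee_fin.
  + by apply: measurable_funTS; apply/measurable_EFinP; exact: bmeas_measurable.
  + by move=> x _; rewrite lee_fin.
Qed.

End pi_system.

(** * Deterministic inequalities for counts and potentials *)

Section counting.
Context (R : realType).

(** Taking [u = - 1 / (x + 2)] in [ln (1 + u) <= u] bounds the increment of [ln] below by
    [1 / (x + 2)], which is at least half of [1 / (x + 1)]. *)
Lemma inv_le_ln_step (x : R) : 0 <= x ->
  (x + 1)^-1 <= 2 * (ln (x + 1 + 1) - ln (x + 1)).
Proof.
move=> x0.
have p1 : 0 < x + 1 by lra.
have p2 : 0 < x + 1 + 1 by lra.
have v2 : 0 < (x + 1 + 1)^-1 by rewrite invr_gt0.
have : ln ((x + 1) / (x + 1 + 1)) <= - (x + 1 + 1)^-1.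
  have -> : (x + 1) / (x + 1 + 1) = 1 + - (x + 1 + 1)^-1 by field; lra.
  apply: le_ln1Dx; rewrite ltrN2 invf_lt1//; lra.
rewrite ln_div// ?posrE// => H.
suff : (x + 1)^-1 <= 2 * (x + 1 + 1)^-1 by lra.
by rewrite -[X in X <= _]mul1r ler_pdivrMr// mulrAC ler_pdivlMr//; lra.
Qed.

(** Only rounds with [a t] contribute, and each of them raises the count by one, so the logarithmic
    increments telescope. *)
Lemma sum_inv_count_le (a : nat -> bool) (n : nat) :
  \sum_(t < n) (a t)%:R / (\sum_(s < t) (a s)%:R + 1) <=
  2 * ln (\sum_(s < n) (a s)%:R + 1) :> R.
Proof.
elim: n => [|n IH]; first by rewrite !big_ord0 add0r ln1 mulr0.
rewrite !big_ord_recr/=; set N := \sum_(s < n) (a s)%:R in IH *.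
have N0 : 0 <= N by apply: sumr_ge0 => i _; exact: ler0n.
case: (a n); last by rewrite mul0r !addr0.
by rewrite mul1r; have := inv_le_ln_step N0; lra.
Qed.

(** Expand the square when [p] holds: the larger denominator only shrinks the [M ^+ 2] term, and the
    squared increment is at most 1. The cross term is kept exactly because its mean will vanish. *)
Lemma potential_step (p e : bool) (M N s : R) : 0 <= N -> 0 <= s <= 1 ->
  (M + p%:R * (e%:R - s)) ^+ 2 / (N + p%:R + 1) <=
  M ^+ 2 / (N + 1) + 2 * (p%:R * M / (N + 1 + 1)) * (e%:R - s)
  + p%:R / (N + 1).
Proof.
move=> N0 s01.
case: p; last by rewrite !(mulr0n, mul0r, mulr0, addr0).
rewrite !(mulr1n, mul1r).
have p1 : 0 < N + 1 by lra.
have p2 : 0 < N + 1 + 1 by lra.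
have -> : (M + (e%:R - s)) ^+ 2 / (N + 1 + 1) = M ^+ 2 / (N + 1 + 1) +
   2 * (M / (N + 1 + 1)) * (e%:R - s) + (e%:R - s) ^+ 2 / (N + 1 + 1).
  by field; lra.
have v12 : (N + 1 + 1)^-1 <= (N + 1)^-1 by rewrite lef_pV2 ?posrE//; lra.
have v2 : 0 < (N + 1 + 1)^-1 by rewrite invr_gt0.
have E : (e%:R - s) ^+ 2 <= 1 by case: e => /=; nra.
have : M ^+ 2 / (N + 1 + 1) <= M ^+ 2 / (N + 1).
  by rewrite ler_wpM2l ?sqr_ge0.
have : (e%:R - s) ^+ 2 / (N + 1 + 1) <= (N + 1)^-1.
  apply: le_trans v12; rewrite -[X in _ <= X]mul1r.
  by rewrite ler_wpM2r// ltW.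
lra.
Qed.

End counting.

(** * Measurability with respect to a generated sub-sigma-algebra *)

Section sub_sigma_algebra.
Context (R : realType) d (Omega : measurableType d).
Implicit Types G : set (set Omega).

(** Retyping [Omega] by [g_sigma_algebraType G] makes every measurability lemma available for the
    sub-sigma-algebra [<<s G >>]. *)
Definition meas_in G dT (V : measurableType dT) (f : Omega -> V) :=
  @measurable_fun _ _ (g_sigma_algebraType G) V [set: Omega] f.

Definition bmeas_in G (f : Omega -> R) := @bmeas _ (g_sigma_algebraType G) R f.

Lemma sigma_sub G G' : G `<=` <<s G' >> -> <<s G >> `<=` <<s G' >>.
Proof. by move=> GG'; apply: smallest_sub => //; exact: smallest_sigma_algebra. Qed.

Lemma sigma_measurable G : G `<=` measurable -> <<s G >> `<=` measurable.
Proof. by move=> GG'; apply: smallest_sub => //; exact: sigma_algebra_measurable. Qed.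

Lemma meas_inP G dT (V : measurableType dT) (f : Omega -> V) :
  (forall A, measurable A -> <<s G >> (f @^-1` A)) <-> meas_in G f.
Proof.
split=> [H _ A mA|H A mA]; first by rewrite setTI; exact: H.
by rewrite -[X in <<s G >> X]setTI; apply: H.
Qed.

Lemma meas_in_sub G G' dT (V : measurableType dT) (f : Omega -> V) :
  G `<=` <<s G' >> -> meas_in G f -> meas_in G' f.
Proof.
move=> GG' /meas_inP H; apply/meas_inP => A mA; exact: sigma_sub GG' _ (H A mA).
Qed.

Lemma bmeas_in_sub G G' f :
  G `<=` <<s G' >> -> bmeas_in G f -> bmeas_in G' f.
Proof. by move=> GG' [mf bf]; split=> //; exact: meas_in_sub mf. Qed.

Lemma meas_in_measurable G dT (V : measurableType dT) (f : Omega -> V) :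
  G `<=` measurable -> meas_in G f -> measurable_fun [set: Omega] f.
Proof.
move=> GG' /meas_inP H _ A mA; rewrite setTI; exact: sigma_measurable GG' _ (H A mA).
Qed.

Lemma bmeas_in_bmeas G f : G `<=` measurable -> bmeas_in G f -> bmeas f.
Proof. by move=> GG' [mf bf]; split=> //; exact: meas_in_measurable mf. Qed.

Lemma measurable_meas_in dT (V : measurableType dT) (f : Omega -> V) :
  measurable_fun [set: Omega] f -> meas_in measurable f.
Proof.
move=> mf; apply/meas_inP => A mA; apply: sub_sigma_algebra.
by rewrite -[X in measurable X]setTI; apply: mf.
Qed.

(** The hypothesis says that [U] and [V] have the same conditional expectation given [<<s G >>]; it
    extends from indicators to bounded weights. *)
Lemma expect_transfer_sigma (P : {finite_measure set Omega -> \bar R}) G (U V W : Omega -> R) :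
  G `<=` measurable -> bmeas U -> bmeas V ->
  (forall A, <<s G >> A -> Rintegral P [set: Omega] (fun x => \1_A x * U x) =
                    Rintegral P [set: Omega] (fun x => \1_A x * V x)) ->
  bmeas_in G W ->
  Rintegral P [set: Omega] (fun x => W x * U x) =
  Rintegral P [set: Omega] (fun x => W x * V x).
Proof.
move=> Gm bU bV H bW.
(* The identity into the coarser space [g_sigma_algebraType G] serves as the map through which the
   weight factors. *)
have mid : @measurable_fun _ _ Omega (g_sigma_algebraType G) [set: Omega] id.
  by move=> _ A mA; rewrite setTI; apply: sigma_measurable Gm _ mA.
exact: (expect_transfer (Z := g_sigma_algebraType G) mid mid bU bV H bW).
Qed.

End sub_sigma_algebra.
Arguments meas_in {d Omega} G {dT V} f.

(** * Sigma-algebras of the history and of the hidden variables *)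

Section history.
Context (R : realType) d (Theta : measurableType d) d' (Omega : measurableType d')
  (g : Theta -> R) (theta : Omega -> Theta) (D : nat -> Omega -> R)
  (thetat : nat -> Omega -> Theta) (T : nat).
Context (mg : measurable_fun [set: Theta] g).

Let X := nv_X g thetat.

(* [<<s info t j >>] is the sigma-algebra of theta, D_0..D_(t-1) and
   theta~_0..theta~_(j-1), presented by a pi-system. *)
Fixpoint info (t j : nat) : set (set Omega) :=
  if j is j'.+1 then
    [set G | exists G' A, <<s info t j' >> G' /\ measurable A /\
       G = G' `&` thetat j' @^-1` A]
  else [set G | exists A (E : nat -> set R), measurable A /\
       (forall i, measurable (E i)) /\
       G = theta @^-1` A `&` \bigcap_(i in `I_t) (D i @^-1` E i)].

Lemma info_setI t j : setI_closed (info t j).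
Proof.
case: j => [|j] /= _ _ [A [E [mA [mE ->]]]] [A' [E' [mA' [mE' ->]]]].
  exists (A `&` A'), (fun i => E i `&` E' i).
  split; first exact: measurableI.
  split; first by move=> i; exact: measurableI.
  by rewrite preimage_setI setIACA -bigcapI.
exists (A `&` A'), (E `&` E').
split.
  by apply: (@measurableI _ (g_sigma_algebraType (info t j))).
by split; [exact: measurableI|rewrite preimage_setI setIACA].
Qed.

Lemma info_sub (G : set (set Omega)) t j : meas_in G theta ->
  (forall i, (i < t)%N -> meas_in G (D i)) ->
  (forall i, (i < j)%N -> meas_in G (thetat i)) ->
  info t j `<=` <<s G >>.
Proof.
move=> mth mD; elim: j => [|j IH] mt /= _ [A [E [mA [mE ->]]]].
  apply: (@measurableI _ (g_sigma_algebraType G)); first by apply/meas_inP : A mA.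
  apply: (@bigcap_measurableType _ (g_sigma_algebraType G)) => // i it.
  by have /meas_inP := mD _ it; apply.
apply: (@measurableI _ (g_sigma_algebraType G)).
  apply: sigma_sub mA; apply: IH => i ij; apply: mt; exact: leqW.
by have /meas_inP := mt _ (ltnSn j); apply.
Qed.

Lemma info_S t j : info t j `<=` <<s info t j.+1 >>.
Proof.
move=> G iG; apply: sub_sigma_algebra => /=.
exists G, setT; split; first exact: sub_sigma_algebra.
by split => //; rewrite preimage_setT setIT.
Qed.

Lemma theta_info t j : meas_in (info t j) theta.
Proof.
elim: j => [|j IH]; last exact: meas_in_sub (@info_S t j) IH.
apply/meas_inP => A mA; apply: sub_sigma_algebra => /=.
exists A, (fun=> setT); split => //; split => //.
by rewrite bigcapT ?setIT// => i _; rewrite preimage_setT.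
Qed.

Lemma D_info t j i : (i < t)%N -> meas_in (info t j) (D i).
Proof.
move=> it; elim: j => [|j IH]; last exact: meas_in_sub (@info_S t j) IH.
apply/meas_inP => A mA; apply: sub_sigma_algebra => /=.
exists setT, (fun k => if k == i then A else setT); split => //; split.
  by move=> k; case: ifP.
rewrite preimage_setT setTI; apply/seteqP; split => w /=.
  by move=> Aw k _ /=; case: ifP => // /eqP ->.
by move=> /(_ i it); rewrite /= eqxx.
Qed.

Lemma thetat_info t j i : (i < j)%N -> meas_in (info t j) (thetat i).
Proof.
elim: j => // j IH; rewrite ltnS leq_eqVlt => /predU1P[->|ij]; last first.
  exact: meas_in_sub (@info_S t j) (IH ij).
apply/meas_inP => A mA; apply: sub_sigma_algebra => /=.
exists setT, A; split; first exact: (@measurableT _ (g_sigma_algebraType (info t j))).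
by split => //; rewrite setTI.
Qed.

Lemma theta_past t : meas_in (past_gen T theta D thetat t) theta.
Proof. by apply/meas_inP => A mA; apply: sub_sigma_algebra; left; exists A. Qed.

Lemma D_past t i : (i < T)%N -> meas_in (past_gen T theta D thetat t) (D i).
Proof.
by move=> iT; apply/meas_inP => A mA; apply: sub_sigma_algebra; right; left; exists i, A.
Qed.

Lemma thetat_past t i : (i < t)%N -> meas_in (past_gen T theta D thetat t) (thetat i).
Proof.
by move=> iT; apply/meas_inP => A mA; apply: sub_sigma_algebra; right; right; exists i, A.
Qed.

(** Each order is [g] of a sample, and each observation is a measurable function of the order and
    the demand. *)
Lemma hist_sub (G : set (set Omega)) t :
  (forall i, (i < t)%N -> meas_in G (D i)) ->
  (forall i, (i < t)%N -> meas_in G (thetat i)) ->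
  hist_gen g D thetat t `<=` <<s G >>.
Proof.
move=> mD mt E [s [st H]].
have mX : meas_in G (X s) by exact: measurableT_comp mg (mt _ st).
move: H => [[A [mA [->|->]]]|->].
- by have /meas_inP := mX; apply.
- have /meas_inP : meas_in G (D s \min X s).
    exact: (@measurable_minr _ (g_sigma_algebraType G)) (mD _ st) mX.
  by apply.
- have := @measurable_fun_ler _ (g_sigma_algebraType G) _ _ _ _ (mD _ st) mX.
  by move=> /(_ measurableT [set true]); rewrite setTI; apply.
Qed.

Lemma X_hist t i : (i < t)%N -> meas_in (hist_gen g D thetat t) (X i).
Proof.
move=> it; apply/meas_inP => A mA; apply: sub_sigma_algebra.
by exists i; split => //; left; exists A; split => //; left.
Qed.

Lemma min_hist t i : (i < t)%N ->
  meas_in (hist_gen g D thetat t) (fun w => Num.min (D i w) (X i w)).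
Proof.
move=> it; apply/meas_inP => A mA; apply: sub_sigma_algebra.
by exists i; split => //; left; exists A; split => //; right.
Qed.

End history.

(** * Posterior identities along a run *)

Section run.
Context (R : realType) d (Theta : measurableType d) (mu : probability Theta R)
  (Q : R.-pker Theta ~> R) (g : Theta -> R)
  d' (Omega : measurableType d') (P : probability Omega R) (T : nat)
  (theta : Omega -> Theta) (D : nat -> Omega -> R)
  (thetat : nat -> Omega -> Theta) (kappa : nat -> Omega -> probability Theta R).
Context (mg : measurable_fun [set: Theta] g)
  (run : thompson_sampling_run mu Q g P T theta D thetat kappa).

Local Notation "''E' f" := (Rintegral P [set: Omega] f) (at level 10, f at level 8).
Local Notation info := (info theta D thetat).
Local Notation hist := (hist_gen g D thetat).
Local Notation past := (past_gen T theta D thetat).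
Local Notation X := (nv_X g thetat).

Let mtheta : measurable_fun [set: Omega] theta. Proof. by case: run. Qed.
Let mD t : measurable_fun [set: Omega] (D t). Proof. by case: run. Qed.
Let mthetat t : measurable_fun [set: Omega] (thetat t). Proof. by case: run. Qed.

(** Lets the inclusions into [<<s G >>] be used with [G] the whole sigma-algebra. *)
Lemma measurable_gen_id : <<s @measurable _ Omega >> = @measurable _ Omega.
Proof. exact/sigma_algebra_id/sigma_algebra_measurable. Qed.

Lemma info_measurable t j : info t j `<=` measurable.
Proof.
rewrite -[X in _ `<=` X]measurable_gen_id.
by apply: info_sub => [|i _|i _]; exact: measurable_meas_in.
Qed.

Lemma hist_measurable t : hist t `<=` measurable.
Proof.
rewrite -[X in _ `<=` X]measurable_gen_id.
by apply: hist_sub => // i _; exact: measurable_meas_in.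
Qed.

Lemma past_measurable t : past t `<=` measurable.
Proof.
move=> G [[A [mA ->]]|[[s [A [_ [mA ->]]]]|[s [A [_ [mA ->]]]]]].
- by rewrite -[X in measurable X]setTI; apply: mtheta.
- by rewrite -[X in measurable X]setTI; apply: mD.
- by rewrite -[X in measurable X]setTI; apply: mthetat.
Qed.

Lemma info_past t j : (t <= T)%N -> info t j `<=` <<s past j >>.
Proof.
move=> tT; apply: info_sub => [|i it|i ij].
- exact: theta_past.
- by apply: D_past; exact: leq_trans it tT.
- exact: thetat_past.
Qed.

Lemma hist_past t : (t <= T)%N -> hist t `<=` <<s past t >>.
Proof.
move=> tT; apply: hist_sub => // i it; last exact: thetat_past.
by apply: D_past; exact: leq_trans it tT.
Qed.

Lemma hist_info t j i : (i <= t)%N -> (i <= j)%N -> hist i `<=` <<s info t j >>.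
Proof.
move=> it ij; apply: hist_sub => // k ki.
- by apply: D_info; exact: leq_trans ki it.
- by apply: thetat_info; exact: leq_trans ki ij.
Qed.

Definition post (A : set Theta) t w : R := fine (kappa t w A).

Lemma post_hist (A : set Theta) t : (t < T)%N -> measurable A -> bmeas_in (hist t) (post A t).
Proof.
move=> tT mA; have [_ _ _ _ /(_ t tT A mA)[H _ _]] := run.
split; last first.
  exists 1 => w; rewrite ger0_norm ?fine_ge0//.
  by rewrite -lee_fin fineK ?fin_num_measure// probability_le1.
(* Open upper rays generate the Borel sets, and their preimages are complements of the sublevel sets
   that the run provides. *)
move=> _; apply: (measurability _ (RGenOInfty.measurableE R)) => //.
move=> _ [_ [a ->] <-]; rewrite setTI.
rewrite (_ : _ @^-1` _ = ~` [set w | (kappa t w A <= a%:E)%E]).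
  exact: (@measurableC _ (g_sigma_algebraType (hist t))) (H a).
apply/seteqP; split => w /=; rewrite in_itv/= andbT /post.
  by move=> H1 H2; move: H2; rewrite -[kappa t w A]fineK ?fin_num_measure// lee_fin leNgt H1.
by move=> /negP; rewrite -[kappa t w A]fineK ?fin_num_measure// lee_fin leNgt negbK.
Qed.

Lemma post_bmeas (A : set Theta) t : (t < T)%N -> measurable A -> bmeas (post A t).
Proof. by move=> tT mA; apply: bmeas_in_bmeas (post_hist tT mA); exact: hist_measurable. Qed.

Let E_indicI (G : set Omega) (A : set Theta) (phi : Omega -> Theta) :
  measurable_fun [set: Omega] phi -> measurable G -> measurable A ->
  ('E (fun w => \1_G w * \1_A (phi w)))%:E = P (phi @^-1` A `&` G).
Proof.
move=> mphi mG mA.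
have mphiA : measurable (phi @^-1` A) by rewrite -[X in measurable X]setTI; apply: mphi.
by rewrite expect_indic_integral//; [exact: integral_indic|exact: bmeas_indic].
Qed.

Let E_post (G : set Omega) (A : set Theta) t : (t < T)%N ->
  measurable G -> measurable A ->
  ('E (fun w => \1_G w * post A t w))%:E = (\int[P]_(w in G) kappa t w A)%E.
Proof.
move=> tT mG mA; rewrite expect_indic_integral//; last exact: post_bmeas.
by apply: eq_integral => w _; rewrite fineK// fin_num_measure.
Qed.

Let bmeas_indic_comp (A : set Theta) (phi : Omega -> Theta) :
  measurable_fun [set: Omega] phi -> measurable A -> bmeas (fun w => \1_A (phi w) : R).
Proof. by move=> mphi mA; apply: bmeas_comp mphi _; exact: bmeas_indic. Qed.

(** The defining identity of the posterior, extended from events of the history to bounded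
    weights. *)
Lemma E_theta_post (A : set Theta) t (W : Omega -> R) : (t < T)%N -> measurable A ->
  bmeas_in (hist t) W ->
  'E (fun w => W w * \1_A (theta w)) = 'E (fun w => W w * post A t w).
Proof.
move=> tT mA; apply: expect_transfer_sigma; first exact: hist_measurable.
- exact: bmeas_indic_comp.
- exact: post_bmeas.
- move=> G hG; have mG : measurable G := sigma_measurable (@hist_measurable t) hG.
  have [_ _ _ _ /(_ t tT A mA)[_ H _]] := run.
  by apply: EFin_inj; rewrite E_indicI// E_post// H.
Qed.

(** The sample is a fresh draw, so the weight may also involve [theta], all [T] demands and the
    earlier samples. This wider choice is what allows samples to be integrated out in [indep]. *)
Lemma E_thetat_post (A : set Theta) t (W : Omega -> R) : (t < T)%N -> measurable A ->
  bmeas_in (past t) W ->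
  'E (fun w => W w * \1_A (thetat t w)) = 'E (fun w => W w * post A t w).
Proof.
move=> tT mA; apply: expect_transfer_sigma; first exact: past_measurable.
- exact: bmeas_indic_comp.
- exact: post_bmeas.
- move=> G hG; have mG : measurable G := sigma_measurable (@past_measurable t) hG.
  have [_ _ _ _ /(_ t tT A mA)[_ _ H]] := run.
  by apply: EFin_inj; rewrite E_indicI// E_post// H.
Qed.

(** Probability matching: given the history, [theta] and [thetat t] both have law [kappa t]. *)
Lemma E_theta_thetat (f : Theta -> R) t (W : Omega -> R) : (t < T)%N -> bmeas f ->
  bmeas_in (hist t) W ->
  'E (fun w => f (theta w) * W w) = 'E (fun w => f (thetat t w) * W w).
Proof.
move=> tT bf bW; have bW' := bmeas_in_bmeas (@hist_measurable t) bW.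
apply: expect_transfer => // A mA.
have comm (phi : Omega -> Theta) : (fun w => \1_A (phi w) * W w) = (fun w => W w * \1_A (phi w)).
  by apply/funext => w; rewrite mulrC.
rewrite !comm (E_theta_post tT mA bW) (E_thetat_post tT mA)//.
by apply: bmeas_in_sub bW; apply: hist_past; exact: ltnW.
Qed.

(** * Regret at a fixed level [y] *)

Section level.
Variable y : R.

Definition tail (th : Theta) : R := fine (Q th `]y, +oo[%classic).

Lemma tail_ge0 th : 0 <= tail th.
Proof. exact: fine_ge0. Qed.

Let Qfin th (A : set R) : measurable A -> Q th A \is a fin_num.
Proof. by move=> mA; exact: (finite_kernel_measure Q th). Qed.

Lemma tail_le1 th : tail th <= 1.
Proof.
rewrite -lee_fin fineK ?Qfin//.
by rewrite -(@prob_kernel _ _ _ _ _ Q th); apply: le_measure; rewrite ?inE.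
Qed.

Lemma tail_bmeas : bmeas tail.
Proof.
split; last by exists 1 => th; rewrite ger0_norm ?tail_ge0 ?tail_le1.
by apply: measurableT_comp => //; exact: measurable_kernel.
Qed.

Lemma tail_theta_bmeas : bmeas (fun w => tail (theta w)).
Proof. exact: bmeas_comp mtheta tail_bmeas. Qed.

Lemma demand_bmeas t : bmeas (fun w => 1{y < D t w} : R).
Proof. by apply: bmeas_ltr => //; exact: measurable_cst. Qed.

(** In the product formula for the joint law, imposing [y < D t] changes the factor of round [t]
    from 1 to [tail]. *)
Lemma indep_base t (G : set Omega) : (t < T)%N -> info t 0 G ->
  'E (fun w => \1_G w * 1{y < D t w}) = 'E (fun w => \1_G w * tail (theta w)).
Proof.
move=> tT [A [E [mA [mE ->]]]].
(* [E1] constrains only the rounds before [t]; [E2] adds the event [y < D t] at round [t]. *)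
pose E1 i := if (i < t)%N then E i else setT.
pose E2 i := if (i < t)%N then E i else if i == t then `]y, +oo[%classic else setT.
have mE1 i : measurable (E1 i) by rewrite /E1; case: ifP.
have mE2 i : measurable (E2 i) by rewrite /E2; case: ifP => // _; case: ifP.
pose H := [set w | forall i : 'I_T, E1 i (D i w)].
have mH : measurable H.
  rewrite (_ : H = \bigcap_(i in `I_T) (D i @^-1` E1 i)); last first.
    apply/seteqP; split => w /= Hw i; first by move=> iT; exact: (Hw (Ordinal iT)).
    exact: (Hw i (ltn_ord i)).
  apply: bigcap_measurableType => i _; rewrite -[X in measurable X]setTI; exact: mD.
have GE : theta @^-1` A `&` \bigcap_(i in `I_t) (D i @^-1` E i) = theta @^-1` A `&` H.
  congr (_ `&` _); apply/seteqP; split => w /= Hw i.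
    by rewrite /E1; case: ifP => // it; exact: Hw.
  move=> it; have := Hw (Ordinal (ltn_trans it tT)); by rewrite /E1 /= it.
rewrite GE.
pose q (F : nat -> set R) th : R := \prod_(i < T) fine (Q th (F i)).
have qE (F : nat -> set R) th : (forall i, measurable (F i)) ->
    (\prod_(i < T) Q th (F i))%E = (q F th)%:E.
  move=> mF; rewrite /q (big_morph EFin EFinM (erefl 1%:E)).
  by apply: eq_bigr => i _; rewrite fineK ?Qfin.
have q01 (F : nat -> set R) th : (forall i, measurable (F i)) -> 0 <= q F th <= 1.
  move=> mF; rewrite /q prodr_ge0/=; last by move=> i _; exact: fine_ge0.
  apply: prodr_ile1 => i _; rewrite fine_ge0//= -lee_fin fineK ?Qfin//.
  by rewrite -(@prob_kernel _ _ _ _ _ Q th); apply: le_measure; rewrite ?inE.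
have bq (F : nat -> set R) : (forall i, measurable (F i)) -> bmeas (q F).
  move=> mF; split; last first.
    by exists 1 => th; have /andP[? ?] := q01 _ th mF; rewrite ger0_norm.
  apply: measurable_prod => i _; apply: measurableT_comp => //; exact: measurable_kernel.
have q2 th : q E2 th = tail th * q E1 th.
  rewrite /q (bigD1 (Ordinal tT))//= [in RHS](bigD1 (Ordinal tT))//=.
  rewrite /E1 /E2 ltnn eqxx prob_kernel mul1r; congr (_ * _).
  apply: eq_bigr => i it; have -> : (nat_of_ord i == t) = false.
    by apply: contraNF it => /eqP it; apply/eqP/val_inj.
  by [].
have joint (A' : set Theta) (F : nat -> set R) : measurable A' ->
    (forall i, measurable (F i)) ->
    P [set w | A' (theta w) /\ forall i : 'I_T, F i (D i w)] =
    (Rintegral mu [set: Theta] (fun th => \1_A' th * q F th))%:E.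
  move=> mA' mF; have [_ _ _ J _] := run.
  rewrite (J A' (fun i : 'I_T => F i))// expect_indic_integral//; last exact: bq.
  by apply: eq_integral => th _; rewrite qE.
have mthA A' : measurable A' -> measurable (theta @^-1` A').
  by move=> mA'; rewrite -[X in measurable X]setTI; exact: mtheta.
have L : 'E (fun w => \1_(theta @^-1` A `&` H) w * 1{y < D t w}) =
    Rintegral mu [set: Theta] (fun th => \1_A th * q E2 th).
  apply: EFin_inj; rewrite -joint//.
  transitivity (P ((theta @^-1` A `&` H) `&` [set w | y < D t w])).
    have my : measurable [set w | y < D t w].
      have := measurable_fun_ltr (measurable_cst y) (mD t) => /(_ measurableT [set true]).
      by rewrite setTI; apply.
    rewrite expect_indic_integral//; last 2 first.
    - by apply: measurableI => //; exact: mthA.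
    - exact: demand_bmeas.
    under eq_integral do rewrite -(indicb R (fun w => y < D t w)).
    rewrite integral_indic//; last by apply: measurableI => //; exact: mthA.
    by rewrite setIC.
  congr (P _); apply/seteqP; split => w /=.
    move=> [[Aw Hw] yD]; split => // i; have := Hw i; rewrite /E1 /E2.
    by case: ifP => // _ _; case: ifP => // /eqP ->; rewrite /= in_itv/= yD.
  move=> [Aw Hw]; split; last first.
    by have := Hw (Ordinal tT); rewrite /E2 /= ltnn eqxx /= in_itv/= andbT.
  by split => // i; have := Hw i; rewrite /E1 /E2; case: ifP.
rewrite L; under eq_Rintegral do rewrite q2 mulrA.
(* This pulls the [mu]-integral back to [Omega]: by the joint law, functions of [theta] paired with
   [H] under [P] integrate as they do against [q E1] under [mu]. *)
have := @expect_transfer R _ Omega _ Theta _ Theta P mu theta id (\1_H) (q E1)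
  (fun th => \1_A th * tail th) mtheta (@measurable_id _ _ _) (bmeas_indic _ mH) (bq _ mE1).
move=> <-.
- apply: eq_Rintegral => w _.
  rewrite indicI /= mulrAC; congr (_ * _).
- move=> A' mA'; apply: EFin_inj; rewrite -joint//.
  transitivity (P (theta @^-1` A' `&` H)); last by [].
  rewrite -E_indicI//; congr (_%:E); apply: eq_Rintegral => w _; exact: mulrC.
- by apply: bmeasM; [exact: bmeas_indic|exact: tail_bmeas].
Qed.

Lemma info0_setT t : info t 0 [set: Omega].
Proof.
exists setT, (fun=> setT); split => //; split => //.
by rewrite preimage_setT setTI bigcapT// => i _; rewrite preimage_setT.
Qed.

Let E_setT (U V : Omega -> R) :
  'E (fun w => \1_[set: Omega] w * U w) = 'E (fun w => \1_[set: Omega] w * V w) ->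
  'E U = 'E V.
Proof.
under eq_Rintegral do rewrite indicT mul1r.
under [in X in _ = X -> _]eq_Rintegral do rewrite indicT mul1r.
by [].
Qed.

(* [D t] is independent of [info t j] given theta, even for [j = t.+1]: each
   theta~_j can be integrated out, as its posterior weight is a function of the
   earlier rounds. *)
Lemma indep t j (W : Omega -> R) : (t < T)%N -> (j <= t.+1)%N ->
  bmeas_in (info t j) W ->
  'E (fun w => W w * 1{y < D t w}) = 'E (fun w => W w * tail (theta w)).
Proof.
move=> tT; elim: j W => [|j IH] W jt; apply: expect_transfer_sigma;
  do 1?[exact: info_measurable|exact: demand_bmeas|exact: tail_theta_bmeas];
  apply: expect_pi_system;
  do 1?[exact: info_setI|exact: info_measurable|exact: demand_bmeas
       |exact: tail_theta_bmeas|by move=> w; exact: ler0n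
       |by move=> w; exact: tail_ge0].
- exact: E_setT (indep_base tT (info0_setT t)).
- by move=> A; exact: indep_base.
(* The equality of total integrals comes from the induction hypothesis with constant weight 1. *)
- have := IH (cst 1) (ltnW jt) (@bmeas_cst _ (g_sigma_algebraType (info t j)) R 1).
  under eq_Rintegral do rewrite mul1r.
  by under [in X in _ = X -> _]eq_Rintegral do rewrite mul1r.
move=> _ [G [A [sG [mA ->]]]].
have jt' : (j <= t)%N by [].
have jT : (j < T)%N := leq_ltn_trans jt' tT.
have mG : measurable G := sigma_measurable (@info_measurable t j) sG.
have bG : bmeas_in (info t j) (\1_G) := @bmeas_indic _ (g_sigma_algebraType (info t j)) R G sG.
have iP : info t j `<=` <<s past j >> by apply: info_past; exact: ltnW.
have bs : bmeas_in (info t j) (fun w => tail (theta w)).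
  apply: (@bmeas_comp _ _ (g_sigma_algebraType (info t j))) tail_bmeas.
  exact: theta_info.
have be : bmeas_in (past j) (fun w => 1{y < D t w} : R).
  apply: (@bmeas_ltr _ (g_sigma_algebraType (past j))) => //; exact: D_past.
have E1 (f : Omega -> R) :
    (fun w => \1_(G `&` thetat j @^-1` A) w * f w) =
    (fun w => (\1_G w * f w) * \1_A (thetat j w)).
  by apply/funext => w; rewrite indicI /= mulrAC.
rewrite !E1 !(E_thetat_post jT mA).
- under eq_Rintegral do rewrite mulrAC.
  rewrite (IH (fun w => \1_G w * post A j w)) ?(ltnW jt)//.
    by apply: eq_Rintegral => w _; rewrite mulrAC.
  apply: (@bmeasM _ (g_sigma_algebraType (info t j))) => //.
  by apply: bmeas_in_sub (post_hist jT mA); exact: hist_info.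
- apply: (@bmeasM _ (g_sigma_algebraType (past j))); first exact: bmeas_in_sub bG.
  exact: bmeas_in_sub bs.
- by apply: (@bmeasM _ (g_sigma_algebraType (past j))) => //; exact: bmeas_in_sub bG.
Qed.

Definition exceed t w : R := 1{y < X t w}.
Definition explored t w : R := \sum_(s < t) 1{y < X s w}.
(** Stated through the censored demand, so that it is a function of the history. *)
Definition seen_above t w : R := \sum_(s < t) 1{y < Num.min (D s w) (X s w)}.
(* The [+ 1] regularises the estimator [seen_above / explored] of the tail when
   no round has been explored yet. *)
Definition deviation t w : R := seen_above t w - tail (theta w) * (explored t w + 1).
Definition potential t w : R := deviation t w ^+ 2 / (explored t w + 1).

Lemma explored_ge0 t w : 0 <= explored t w.
Proof. by apply: sumr_ge0 => i _; exact: ler0n. Qed.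

Lemma explored_hist t : bmeas_in (hist t) (explored t).
Proof.
apply: (@bmeas_sum _ (g_sigma_algebraType (hist t)) _ _ (fun s w => 1{y < X s w})).
move=> s st; apply: (@bmeas_ltr _ (g_sigma_algebraType (hist t))) => //; exact: X_hist.
Qed.

Lemma seen_above_hist t : bmeas_in (hist t) (seen_above t).
Proof.
apply: (@bmeas_sum _ (g_sigma_algebraType (hist t)) _ _
  (fun s w => 1{y < Num.min (D s w) (X s w)})).
move=> s st; apply: (@bmeas_ltr _ (g_sigma_algebraType (hist t))) => //; exact: min_hist.
Qed.

Lemma inv_explored_hist t : bmeas_in (hist t) (fun w => (explored t w + 1)^-1).
Proof.
apply: (@bmeasV1 _ (g_sigma_algebraType (hist t))) => [w|]; first exact: explored_ge0.
by case: (explored_hist t).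
Qed.

Lemma hist_bmeas t (W : Omega -> R) : bmeas_in (hist t) W -> bmeas W.
Proof. exact: bmeas_in_bmeas (@hist_measurable t). Qed.

Lemma exceed_bmeas t : bmeas (exceed t).
Proof.
apply: bmeas_ltr; first exact: measurable_cst.
exact: measurableT_comp mg (mthetat t).
Qed.

Lemma deviation_bmeas t : bmeas (deviation t).
Proof.
apply: bmeasB; first exact: hist_bmeas (seen_above_hist t).
apply: bmeasM; first exact: tail_theta_bmeas.
by apply: bmeasD; [exact: hist_bmeas (explored_hist t)|exact: bmeas_cst].
Qed.

Lemma potential_bmeas t : bmeas (potential t).
Proof.
apply: bmeasM; last exact: hist_bmeas (inv_explored_hist t).
by under eq_fun do rewrite expr2; apply: bmeasM; exact: deviation_bmeas.
Qed.

(** The weight involves [theta] through the deviation and the current order through [exceed], hence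
    the sample of round [t] but not its demand. *)
Lemma cross_weight_info t : (t < T)%N ->
  bmeas_in (info t t.+1) (fun w => exceed t w * deviation t w / (explored t w + 1 + 1)).
Proof.
move=> tT; pose GT := g_sigma_algebraType (info t t.+1).
have hi W : bmeas_in (hist t) W -> @bmeas _ GT R W.
  by apply: bmeas_in_sub; apply: hist_info.
have b1 : @bmeas _ GT R (fun w => explored t w + 1).
  by apply: bmeasD; [exact/hi/explored_hist|exact: bmeas_cst].
apply: (@bmeasM _ GT); first apply: (@bmeasM _ GT).
- apply: (@bmeas_ltr _ GT); first exact: measurable_cst.
  by apply: (measurableT_comp mg); apply: thetat_info.
- apply: (@bmeasB _ GT); first exact/hi/seen_above_hist.
  apply: (@bmeasM _ GT) => //.
  by apply: (@bmeas_comp _ _ GT) tail_bmeas; exact: theta_info.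
- apply: (@bmeasV1 _ GT) => [w|]; first by rewrite addr_ge0 ?explored_ge0.
  exact: bmeas_measurable b1.
Qed.

Lemma exceed_inv_bmeas t : bmeas (fun w => exceed t w / (explored t w + 1)).
Proof. by apply: bmeasM; [exact: exceed_bmeas|exact: hist_bmeas (inv_explored_hist t)]. Qed.

Lemma expect_cst (r : R) : 'E (fun=> r) = r.
Proof. by rewrite Rintegral_cst// [X in fine X](@probability_setT _ _ _ P) mulr1. Qed.

Lemma E_potential_le t : (t <= T)%N ->
  'E (potential t) <= 1 + \sum_(s < t) 'E (fun w => exceed s w / (explored s w + 1)).
Proof.
elim: t => [_|t IH tT].
  rewrite big_ord0 addr0 -[X in _ <= X]expect_cst.
  apply: expect_le; [exact: potential_bmeas|exact: bmeas_cst|move=> w].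
  (* Before any round the deviation is [- tail], so the potential starts at a square in [[0, 1]]. *)
  rewrite /potential /deviation /explored /seen_above !big_ord0 !add0r mulr1 sqrrN divr1.
  by rewrite expr_le1// ?tail_le1 ?tail_ge0.
rewrite big_ord_recr/= addrA.
have bp := potential_bmeas t; have ba := exceed_inv_bmeas t.
have bc := bmeas_in_bmeas (@info_measurable t t.+1) (cross_weight_info tT).
pose c w : R := exceed t w * deviation t w / (explored t w + 1 + 1).
have bce : bmeas (fun w => c w * 1{y < D t w}) by apply: bmeasM => //; exact: demand_bmeas.
have bcs : bmeas (fun w => c w * tail (theta w)) by apply: bmeasM => //; exact: tail_theta_bmeas.
apply: le_trans (_ : 'E (fun w => potential t w +
   2 * (c w * 1{y < D t w} - c w * tail (theta w)) + exceed t w / (explored t w + 1)) <= _).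
  apply: expect_le; first exact: potential_bmeas.
    by apply: bmeasD => //; apply: bmeasD => //; apply: bmeasZ; exact: bmeasB.
  move=> w; rewrite /potential.
  have -> : explored t.+1 w = explored t w + exceed t w by rewrite /explored big_ord_recr.
  have -> : deviation t.+1 w = deviation t w + exceed t w * (1{y < D t w} - tail (theta w)).
    rewrite /deviation /explored /seen_above !big_ord_recr/= -/(exceed t w).
    have -> : 1{y < Num.min (D t w) (X t w)} = exceed t w * 1{y < D t w} :> R.
      rewrite /exceed lt_min; case: (_ < D t w); case: (_ < X t w) => /=; ring.
    ring.
  rewrite -mulrBr mulrA /exceed /c; apply: potential_step; first exact: explored_ge0.
  by rewrite tail_ge0 tail_le1.
rewrite expect_add//; last by apply: bmeasD => //; apply: bmeasZ; exact: bmeasB.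
rewrite expect_add//; last by apply: bmeasZ; exact: bmeasB.
rewrite expect_scale; last exact: bmeasB.
(* The cross term vanishes in mean: given [theta], [D t] is independent of its weight. *)
rewrite expect_sub// (indep tT (leqnn _) (cross_weight_info tT)) subrr mulr0 addr0.
by rewrite lerD2r; apply: IH; exact: ltnW.
Qed.

Lemma sum_E_exceed_le n :
  \sum_(s < n) 'E (fun w => exceed s w / (explored s w + 1)) <= 2 * ln (n%:R + 1).
Proof.
rewrite -(expect_sum _ (F := fun s w => exceed s w / (explored s w + 1))); last first.
  by move=> s _; exact: exceed_inv_bmeas.
rewrite -[X in _ <= X]expect_cst; apply: expect_le; last 1 first.
- move=> w; apply: le_trans (sum_inv_count_le _ (fun s => y < X s w) n) _.
  rewrite ler_pM2l// ler_ln ?posrE ?ltr_wpDl ?sumr_ge0// lerD2r.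
  rewrite -[X in _ <= X%:R](card_ord n) -sum1_card natr_sum; apply: ler_sum => s _.
  by case: (_ < _).
- by apply: (bmeas_sum (F := fun s w => exceed s w / (explored s w + 1))) => s _; exact: exceed_inv_bmeas.
- exact: bmeas_cst.
Qed.

(** Apply [z <= r / 2 + z ^+ 2 / r] to [z = m] and [z = - m], according to which of [p] and [f]
    holds; the left side is zero when they agree. *)
Lemma young_step (p f : bool) (m v r : R) : 0 < r -> 0 <= v ->
  (p%:R - f%:R) * (m * v) <= r / 2 * (p%:R * v + f%:R * v) + r^-1 * (m ^+ 2 * v).
Proof.
move=> r0 v0.
have H (z : R) : z <= r / 2 + r^-1 * z ^+ 2.
  rewrite -(ler_pM2l r0) mulrDr mulVKf ?gt_eqF//.
  have := sqr_ge0 (z - r / 2); rewrite !expr2; have := sqr_ge0 r; rewrite expr2; lra.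
have H1 := ler_wpM2r v0 (H m); have H2 := ler_wpM2r v0 (H (- m)); rewrite sqrrN in H2.
have H3 : 0 <= r^-1 * (m ^+ 2 * v) by rewrite mulr_ge0 ?invr_ge0 ?(ltW r0)// mulr_ge0 ?sqr_ge0.
have H4 : 0 <= r * v by rewrite mulr_ge0// ltW.
case: p; case: f; rewrite !(mulr1n, mulr0n); lra.
Qed.

Lemma level_regret_le (r := Num.sqrt T%:R : R) : (0 < T)%N ->
  \sum_(t < T) 'E (fun w => (1{y < g (theta w)} - exceed t w) * tail (theta w)) <=
  r * (1 + 4 * ln (T%:R + 1)).
Proof.
move=> T0; have r0 : 0 < r by rewrite sqrtr_gt0 ltr0n.
set L := ln _.
have step t : (t < T)%N ->
    'E (fun w => (1{y < g (theta w)} - exceed t w) * tail (theta w)) <=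
    r * 'E (fun w => exceed t w / (explored t w + 1)) + r^-1 * (1 + 2 * L).
  move=> tT.
  have bf : bmeas (fun th => 1{y < g th} : R).
    by apply: bmeas_ltr => //; exact: measurable_cst.
  have bfth : bmeas (fun w => 1{y < g (theta w)} : R) := bmeas_comp mtheta bf.
  have bi := hist_bmeas (inv_explored_hist t).
  have bz := hist_bmeas (seen_above_hist t).
  have ba := exceed_bmeas t.
  have hS : bmeas_in (hist t) (fun w => seen_above t w / (explored t w + 1)).
    apply: (@bmeasM _ (g_sigma_algebraType (hist t))).
      exact: seen_above_hist.
    exact: inv_explored_hist.
  have eS := E_theta_thetat tT bf hS.
  have eI := E_theta_thetat tT bf (inv_explored_hist t).
  have bS := hist_bmeas hS.
  have bd : bmeas (fun w => 1{y < g (theta w)} - exceed t w) by exact: bmeasB.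
  have bs := tail_theta_bmeas.
  (* The tail is the estimator minus [deviation / (explored + 1)]. The estimator depends on the
     history only, so probability matching cancels its contribution. *)
  apply: le_trans (_ : 'E (fun w => (exceed t w - 1{y < g (theta w)}) *
     (deviation t w * (explored t w + 1)^-1)) <= _).
    have -> : 'E (fun w => (exceed t w - 1{y < g (theta w)}) * (deviation t w / (explored t w + 1)))
        = 'E (fun w => (1{y < g (theta w)} - exceed t w) * tail (theta w)
          - (1{y < g (theta w)} * (seen_above t w / (explored t w + 1)) -
             exceed t w * (seen_above t w / (explored t w + 1)))).
      apply: eq_Rintegral => w _; rewrite /deviation; field.
      by rewrite gt_eqF// ltr_wpDl// explored_ge0.
    rewrite expect_sub; [|exact: bmeasM|by apply: bmeasB; exact: bmeasM].
    rewrite expect_sub; [|exact: bmeasM|exact: bmeasM].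
    by rewrite eS subrr subr0.
  (* Young's inequality with [r = sqrt T], which balances the logarithmic sum weighted by [r]
     against [T] potentials weighted by [r^-1]. *)
  apply: le_trans (_ : 'E (fun w => r / 2 * (exceed t w / (explored t w + 1) +
     1{y < g (theta w)} / (explored t w + 1)) + r^-1 * potential t w) <= _).
    apply: expect_le.
    - apply: bmeasM; first exact: bmeasB.
      by apply: bmeasM => //; exact: deviation_bmeas.
    - apply: bmeasD; last by apply: bmeasZ; exact: potential_bmeas.
      by apply: bmeasZ; apply: bmeasD; exact: bmeasM.
    - move=> w; apply: young_step => //.
      by rewrite invr_ge0 addr_ge0 ?explored_ge0.
  have bp := potential_bmeas t.
  rewrite expect_add; last 2 first.
  - by apply: bmeasZ; apply: bmeasD; exact: bmeasM.
  - exact: bmeasZ.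
  rewrite !expect_scale//; last by apply: bmeasD; exact: bmeasM.
  rewrite expect_add; [|exact: bmeasM|exact: bmeasM].
  (* Probability matching turns the indicator for [theta] into [exceed t], and the two halves
     merge. *)
  rewrite eI -/(exceed t).
  apply: lerD; first by rewrite le_eqVlt; apply/orP; left; apply/eqP; rewrite /exceed /nv_X; field.
  rewrite ler_pM2l ?invr_gt0//; apply: le_trans (E_potential_le (ltnW tT)) _.
  rewrite lerD2l; apply: le_trans (sum_E_exceed_le t) _.
  by rewrite ler_pM2l// ler_ln ?posrE ?ltr_wpDl// lerD2r ler_nat ltnW.
apply: le_trans (_ : \sum_(t < T) (r * 'E (fun w => exceed t w / (explored t w + 1)) +
    r^-1 * (1 + 2 * L)) <= _).
  by apply: ler_sum => t _; exact: step.
rewrite big_split/= -mulr_sumr sumr_const card_ord.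
have -> : r^-1 * (1 + 2 * L) *+ T = r * (1 + 2 * L).
  rewrite -mulr_natl mulrA; congr (_ * _).
  have -> : T%:R = r * r :> R by rewrite -expr2 sqr_sqrtr.
  by field; rewrite gt_eqF.
rewrite -mulrDr ler_pM2l//; have := sum_E_exceed_le T; rewrite -/L; lra.
Qed.

End level.
End run.

(** * Level decomposition of the newsvendor loss *)

Section loss.
Context (R : realType) (B h b : R).
Context (B0 : 0 < B) (h0 : 0 < h) (b0 : 0 < b).

Lemma nv_lossE x d : nv_loss h b x d = b * d + h * x - (h + b) * Num.min d x.
Proof.
rewrite /nv_loss.
case: (leP d x) => dx.
  by rewrite max_l ?subr_ge0// max_r ?subr_le0//; ring.
by rewrite max_r ?subr_le0 ?ltW// max_l ?subr_ge0 ?ltW//; ring.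
Qed.

(** The grid replaces [Num.min d x] and [Num.min d x'], each within [B / K%:R]; these two errors
    give the last term. *)
Lemma nv_loss_diff_le (K : nat) (x x' d : R) : (0 < K)%N ->
  0 <= x <= B -> 0 <= x' <= B -> 0 <= d <= B ->
  nv_loss h b x d - nv_loss h b x' d <= h * (x - x') +
    (h + b) * (\sum_(k < K) (B / K%:R) *
       ((1{k%:R * (B / K%:R) < x'} - 1{k%:R * (B / K%:R) < x}) *
         1{k%:R * (B / K%:R) < d})) + 2 * (h + b) * (B / K%:R).
Proof.
move=> K0 x0 x'0 dd; set delta := B / K%:R.
have delta0 : 0 < delta by rewrite divr_gt0// ltr0n.
have KB : K%:R * delta = B by rewrite mulrC divfK// pnatr_eq0 -lt0n.
have app z : 0 <= z <= B ->
    `|\sum_(k < K) delta * 1{k%:R * delta < Num.min d z} - Num.min d z| <= delta.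
  move=> /andP[z0 zB]; apply: grid_sum_approx => //.
    by rewrite le_min z0; case/andP: dd => ->.
  by rewrite KB ge_min zB orbT.
have := app _ x0; have := app _ x'0; rewrite !ler_norml !nv_lossE.
have -> : \sum_(k < K) delta *
    ((1{k%:R * delta < x'} - 1{k%:R * delta < x}) * 1{k%:R * delta < d}) =
    \sum_(k < K) delta * 1{k%:R * delta < Num.min d x'} -
    \sum_(k < K) delta * 1{k%:R * delta < Num.min d x}.
  rewrite -sumrB; apply: eq_bigr => k _; rewrite -mulrBr; congr (_ * _).
  rewrite !lt_min; case: (_ < d); rewrite ?andbF/= ?mulr1n ?mulr0n; ring.
set S' := \sum_(k < K) _; set S := \sum_(k < K) _.
move=> /andP[H2 _] /andP[_ H1].
have hb : 0 < h + b by exact: addr_gt0.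
have : 0 <= (h + b) * (2 * delta + (S' - S) - (Num.min d x' - Num.min d x)).
  apply: mulr_ge0; first exact: ltW. clear -H1 H2; lra.
lra.
Qed.

(** Projection onto [[0, B]]: almost surely the identity for a law carried by [[0, B]], it makes the
    loss bounded everywhere. *)
Definition clip (d : R) : R := Num.max 0 (Num.min d B).

Lemma clip_itv d : 0 <= clip d <= B.
Proof.
rewrite /clip le_max lexx ge_max ge_min lexx orbT andbT /=.
exact: ltW.
Qed.

Lemma clip_id d : 0 <= d <= B -> clip d = d.
Proof. by move=> /andP[d0 dB]; rewrite /clip min_l// max_r. Qed.

Lemma measurable_clip : measurable_fun [set: R] clip.
Proof.
apply: (@measurable_maxr _ _ _ _ (cst 0)); first exact: measurable_cst.
apply: (@measurable_minr _ _ _ _ id (cst B)); [exact: measurable_id|exact: measurable_cst].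
Qed.

Lemma bmeas_clip_loss x : bmeas (fun d => nv_loss h b x (clip d)).
Proof.
have bc : bmeas clip.
  split; first exact: measurable_clip.
  by exists B => d; have /andP[? ?] := clip_itv d; rewrite ger0_norm.
under eq_fun do rewrite nv_lossE.
apply: bmeasB; first by apply: bmeasD; [exact: bmeasZ|exact: bmeas_cst].
apply: bmeasZ; split.
  apply: (@measurable_minr _ _ _ _ clip (cst x)); first exact: measurable_clip.
  exact: measurable_cst.
exists (B + `|x|) => d; have /andP[c0 cB] := clip_itv d.
have nx := normr_ge0 x.
by case: (leP (clip d) x) => _; [rewrite ger0_norm//; lra|lra].
Qed.

Lemma nv_f_clip (m : probability R R) x : m `[0, B]%classic = 1%E ->
  nv_f h b m x = (Rintegral m [set: R] (fun d => nv_loss h b x (clip d)))%:E.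
Proof.
move=> mB; rewrite -bmeas_integralE; last exact: bmeas_clip_loss.
apply: ae_eq_integral => //.
- apply/measurable_EFinP.
  apply: (eq_measurable_fun (fun d => b * d + h * x - (h + b) * Num.min d x)).
    by move=> d _; rewrite nv_lossE.
  apply: measurable_funB; first apply: measurable_funD.
  + by apply: measurable_funM.
  + exact: measurable_cst.
  + apply: measurable_funM => //.
    by apply: (@measurable_minr _ _ _ _ id (cst x)).
- by apply/measurable_EFinP; case: (bmeas_clip_loss x).
- exists (~` `[0, B]%classic); split.
  + exact: measurableC.
  + by rewrite [LHS]probability_setC// mB subee.
  + move=> d /= H1 H2; apply: H1 => _; rewrite clip_id//.
Qed.

End loss.

(* Unlike [ge0_le_integral], no measurability is required: the integral of a
   nonnegative function is a supremum over simple functions below it. *)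
Lemma ge0_le_integralT d (T : measurableType d) (R : realType)
    (mu : {measure set T -> \bar R}) (f1 f2 : T -> \bar R) :
  (forall x, (0 <= f1 x)%E) -> (forall x, (f1 x <= f2 x)%E) ->
  (\int[mu]_x f1 x <= \int[mu]_x f2 x)%E.
Proof.
move=> f10 f12; rewrite !ge0_integralTE//; last by move=> x; exact: le_trans (f10 x) (f12 x).
apply: le_ereal_sup => _ [s sf <-]; exists s => //= x.
exact: le_trans (sf x) (f12 x).
Qed.

(** * Expected cost under the demand kernel *)

Section kernel_loss.
Context (R : realType) (B h b : R) d (Theta : measurableType d)
  (Q : R.-pker Theta ~> R) (g : Theta -> R).
Context (B0 : 0 < B) (h0 : 0 < h) (b0 : 0 < b)
  (QB : forall th, Q th `[0, B]%classic = 1%E).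

(* A copy of [Q th] carrying the canonical structure of probability. *)
Definition klaw (th : Theta) : set R -> \bar R := Q th.

HB.instance Definition _ th := Measure.on (klaw th).
HB.instance Definition _ th :=
  Measure_isProbability.Build _ _ _ (klaw th) (prob_kernel th).

Definition cost th x := Rintegral (klaw th) [set: R] (fun d => nv_loss h b x (clip B d)).

Lemma nv_f_cost th x : nv_f h b (Q th) x = (cost th x)%:E.
Proof. exact: (nv_f_clip h b B0 x (m := klaw th) (QB th)). Qed.

Lemma nv_opt_cost th : argmin_selection B h b Q g ->
  nv_opt B h b (Q th) = (cost th (g th))%:E.
Proof.
move=> [_ gB gmin]; rewrite -nv_f_cost; apply/eqP; rewrite eq_le; apply/andP; split.
  by apply: ereal_inf_lbound; exists (g th) => //; exact: gB.
by apply: le_ereal_inf_tmp => _ [x xB <-]; exact: gmin.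
Qed.

Lemma cost_diff_le (K : nat) th x x' : (0 < K)%N ->
  0 <= x <= B -> 0 <= x' <= B ->
  cost th x - cost th x' <= h * (x - x') +
    (h + b) * (\sum_(k < K) (B / K%:R) *
       ((1{k%:R * (B / K%:R) < x'} - 1{k%:R * (B / K%:R) < x}) *
         tail Q (k%:R * (B / K%:R)) th)) + 2 * (h + b) * (B / K%:R).
Proof.
move=> K0 xB x'B; set delta := B / K%:R.
have d0 : 0 < delta by rewrite divr_gt0// ltr0n.
have mI k : measurable [set e | k%:R * delta < clip B e].
  have := measurable_fun_ltr (measurable_cst (k%:R * delta)) (measurable_clip B).
  by move=> /(_ measurableT [set true]); rewrite setTI; apply.
have bI k : bmeas (fun e => 1{k%:R * delta < clip B e} : R) by exact: bmeas_bool.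
(* Nodes with [k < K] lie in [[0, B)], where clipping does not change whether the demand exceeds the
   node. *)
have tailE k : (k < K)%N ->
    Rintegral (klaw th) [set: R] (fun e => 1{k%:R * delta < clip B e}) =
    tail Q (k%:R * delta) th :> R.
  move=> kK; have kd : 0 <= k%:R * delta by rewrite mulr_ge0// ltW.
  have kB : k%:R * delta < B.
    by rewrite mulrC -mulrA gtr_pMr// mulrC ltr_pdivrMr ?mul1r ?ltr_nat// ltr0n (leq_trans _ kK).
  have lawE : (\int[klaw th]_e (1{k%:R * delta < clip B e})%:E)%E =
      Q th `]k%:R * delta, +oo[%classic.
    under eq_integral do rewrite -(indicb R (fun e => k%:R * delta < clip B e)).
    rewrite integral_indic// setIT; congr (Q th _); apply/seteqP; split => e /=.
      by rewrite in_itv/= andbT /clip lt_max ltNge kd/= lt_min => /andP[].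
    by rewrite in_itv/= andbT /clip lt_max lt_min kB andbT => ->; rewrite orbT.
  by rewrite /Rintegral lawE.
pose c k : R := delta * (1{k%:R * delta < x'} - 1{k%:R * delta < x}).
pose F (k : nat) e : R := c k * 1{k%:R * delta < clip B e}.
have bF k : bmeas (F k) by exact: bmeasZ.
have bS : bmeas (fun e => \sum_(k < K) F k e) by exact: bmeas_sum.
have bl z := bmeas_clip_loss h b B0 z.
rewrite /cost -expect_sub//.
pose a := h * (x - x') + 2 * (h + b) * delta.
apply: le_trans (_ : Rintegral (klaw th) [set: R]
    (fun e => a + (h + b) * \sum_(k < K) F k e) <= _).
  apply: expect_le; first exact: bmeasB.
    by apply: bmeasD; [exact: bmeas_cst|exact: bmeasZ].
  move=> e; apply: le_trans (nv_loss_diff_le B0 h0 b0 K0 xB x'B (clip_itv B0 e)) _.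
  rewrite -/delta /a [X in _ <= X]addrAC lerD2r lerD2l /F /c.
  by under eq_bigr do rewrite mulrA.
rewrite expect_add; [|exact: bmeas_cst|exact: bmeasZ].
rewrite expect_scale// Rintegral_cst// [X in fine X](@probability_setT _ _ _ (klaw th)) mulr1.
rewrite expect_sum// /a [X in X <= _]addrAC lerD2r lerD2l.
rewrite le_eqVlt; apply/orP; left; apply/eqP; congr (_ * _); apply: eq_bigr => k _.
rewrite [LHS](@expect_scale _ _ _ (klaw th) (c k) _ (bI k)) tailE//.
exact: esym (mulrA _ _ _).
Qed.

End kernel_loss.

(** * Logarithms of the horizon and the final bound *)

Lemma ln_horizon_bound (R : realType) (T : nat) : (2 <= T)%N ->
  1 / 2 <= ln T%:R :> R /\ ln (T%:R + 1) <= 2 * ln T%:R :> R.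
Proof.
move=> T2; have T2R : 2 <= T%:R :> R by rewrite (ler_nat _ 2).
have T0 : 0 < T%:R :> R by lra.
split.
  have : ln 2 <= ln T%:R :> R by rewrite ler_ln ?posrE.
  (* This gives [ln 2 >= 1 / 2]. *)
  have : ln (1 + - (1 / 2)) <= - (1 / 2) :> R by apply: le_ln1Dx; lra.
  have -> : 1 + - (1 / 2) = 2^-1 :> R by field.
  rewrite lnV ?posrE//; lra.
have -> : 2 * ln T%:R = ln (T%:R * T%:R) :> R by rewrite lnM ?posrE//; ring.
by rewrite ler_ln ?posrE ?mulr_gt0//; nra.
Qed.

Theorem theorem3p4 (R : realType) (B h b : R) :
  0 < B -> 0 < h -> 0 < b ->
  exists (C : R) (k : nat),
  forall (d : measure_display) (Theta : measurableType d)
    (mu : probability Theta R) (Q : R.-pker Theta ~> R) (g : Theta -> R)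
    (d' : measure_display) (Omega : measurableType d') (P : probability Omega R)
    (T : nat) (theta : Omega -> Theta) (D : nat -> Omega -> R)
    (thetat : nat -> Omega -> Theta) (kappa : nat -> Omega -> probability Theta R),
  (forall x, Q x `[0, B]%classic = 1%E) ->
  argmin_selection B h b Q g ->
  thompson_sampling_run mu Q g P T theta D thetat kappa ->
  (2 <= T)%N ->
  (bayes_regret B h b Q g P T theta thetat <=
     (C * Num.sqrt (T%:R) * (ln (T%:R)) ^+ k)%:E)%E.
Proof.
(* With [L = ln T], [r = sqrt T >= 1] and [1 <= 2 * L], the factor [r * (1 + 4 * ln (T + 1)) + 2] is
   at most [(2 + 8 + 4) * r * L]. *)
move=> B0 h0 b0; exists (14 * (h + b) * B), 1%N.
move=> d Theta mu Q g d' Omega P T theta D thetat kappa QB gsel run T2.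
have [mg gB gmin] := gsel.
have T0 : (0 < T)%N by exact: ltnW.
have [mtheta _ mthetat _ _] := run.
have hb : 0 < h + b by exact: addr_gt0.
have gitv th : 0 <= g th <= B by have := gB th; rewrite in_itv.
pose r := Num.sqrt T%:R : R.
(* With [T] nodes the discretisation error is [2 * (h + b) * B / T] per round, a constant over the
   horizon. *)
pose delta := B / T%:R.
have TR0 : 0 < T%:R :> R by rewrite ltr0n.
have delta0 : 0 < delta by rewrite divr_gt0.
have TB : T%:R * delta = B by rewrite mulrC divfK// gt_eqF.
pose gap (k t : nat) w : R :=
  (1{k%:R * delta < g (theta w)} - 1{k%:R * delta < nv_X g thetat t w})
    * tail Q (k%:R * delta) (theta w).
pose U (t : nat) w : R := h * (nv_X g thetat t w - g (theta w)) +
  (h + b) * (\sum_(k < T) delta * gap k t w) + 2 * (h + b) * delta.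
pose reg (t : nat) w : R := cost B h b Q (theta w) (nv_X g thetat t w)
  - cost B h b Q (theta w) (g (theta w)).
have regE w : (\sum_(t < T) (nv_f h b (Q (theta w)) (nv_X g thetat t w)
    - nv_opt B h b (Q (theta w))))%E = (\sum_(t < T) reg t w)%:E.
  rewrite (nv_opt_cost B0 QB _ gsel) -sumEFin; apply: eq_bigr => t _.
  by rewrite (nv_f_cost h b B0 QB).
have reg0 t w : 0 <= reg t w.
  rewrite subr_ge0 -lee_fin -!(nv_f_cost h b B0 QB).
  by apply: gmin; exact: gB.
have regU t w : reg t w <= U t w by
  exact: (cost_diff_le Q B0 h0 b0 (theta w) T0 (gitv _) (gitv _)).
have bg : bmeas g.
  by split => //; exists B => th; have /andP[? ?] := gitv th; rewrite ger0_norm.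
have bgt t : bmeas (fun w => nv_X g thetat t w) by exact: bmeas_comp (mthetat t) bg.
have bgth : bmeas (fun w => g (theta w)) by exact: bmeas_comp mtheta bg.
have bgap k t : bmeas (gap k t).
  apply: bmeasM; last exact: bmeas_comp mtheta (tail_bmeas Q _).
  by apply: bmeasB; apply: bmeas_ltr; do 1?[exact: measurable_cst];
    [case: bgth|case: (bgt t)].
have bS t : bmeas (fun w => \sum_(k < T) delta * gap k t w).
  by apply: (bmeas_sum (F := fun k w => delta * gap k t w)) => k _; exact: bmeasZ.
have bU t : bmeas (U t).
  apply: bmeasD; last exact: bmeas_cst.
  by apply: bmeasD; apply: bmeasZ => //; exact: bmeasB.
have EU t : (t < T)%N -> Rintegral P [set: Omega] (U t) =
    (h + b) * \sum_(k < T) delta * Rintegral P [set: Omega] (gap k t)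
    + 2 * (h + b) * delta.
  move=> tT.
  rewrite expect_add; [|by apply: bmeasD; apply: bmeasZ => //; exact: bmeasB|exact: bmeas_cst].
  rewrite expect_cst; congr (_ + _).
  rewrite expect_add; [|by apply: bmeasZ; exact: bmeasB|exact: bmeasZ].
  rewrite !expect_scale//; last exact: bmeasB.
  rewrite expect_sub//.
  (* Probability matching with weight 1 gives equal means to the played and the optimal orders, so
     the term linear in [h] vanishes. *)
  have := E_theta_thetat mg run tT bg
    (@bmeas_cst _ (g_sigma_algebraType (hist_gen g D thetat t)) R 1).
  under eq_Rintegral do rewrite mulr1.
  under [in X in _ = X -> _]eq_Rintegral do rewrite mulr1.
  move=> ->; rewrite subrr mulr0 add0r; congr (_ * _).
  rewrite (expect_sum _ (F := fun k w => delta * gap k t w)); last by move=> k _; exact: bmeasZ.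
  by apply: eq_bigr => k _; rewrite expect_scale.
rewrite /bayes_regret; under eq_integral do rewrite regE.
(* The regret, nonnegative since [g] minimises the cost, is replaced by the bounded measurable [U]
   before expectations are split. *)
apply: le_trans (_ : (\int[P]_w (\sum_(t < T) U t w)%:E <= _)%E).
  apply: ge0_le_integralT => w; rewrite lee_fin; first by apply: sumr_ge0.
  by apply: ler_sum => t _.
have bSU : bmeas (fun w => \sum_(t < T) U t w) by exact: bmeas_sum.
rewrite bmeas_integralE// lee_fin (expect_sum _ (F := U))//.
under eq_bigr do rewrite EU//.
have [L1 L2] := ln_horizon_bound R T2.
have r1 : 1 <= r.
  by rewrite -[X in X <= _]sqrtr1 ler_sqrt ?ler1n// ltW.
rewrite big_split/= -mulr_sumr exchange_big/= sumr_const card_ord.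
(* With the node as outer index, the level bound applies to each node, and the node weights add up
   to [B]. *)
have step : \sum_(k < T) \sum_(t < T) delta * Rintegral P [set: Omega] (gap k t) <=
    B * (r * (1 + 4 * ln (T%:R + 1))).
  have -> : B * (r * (1 + 4 * ln (T%:R + 1))) =
      \sum_(k < T) delta * (r * (1 + 4 * ln (T%:R + 1))) :> R.
    by rewrite sumr_const card_ord -[RHS]mulr_natl [RHS]mulrA TB.
  apply: ler_sum => k _; rewrite -mulr_sumr ler_pM2l//.
  exact: (level_regret_le mg run).
have -> : 2 * (h + b) * delta *+ T = 2 * (h + b) * B.
  by rewrite -mulr_natl mulrCA TB.
rewrite expr1 -/r.
set L := ln T%:R in L1 L2 *; set L' := ln _ in L2 step *.
apply: le_trans (_ : (h + b) * (B * (r * (1 + 4 * L'))) + 2 * (h + b) * B <= _).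
  by rewrite lerD2r ler_pM2l.
have -> : (h + b) * (B * (r * (1 + 4 * L'))) + 2 * (h + b) * B =
   ((h + b) * B) * (r * (1 + 4 * L') + 2) by ring.
have -> : 14 * (h + b) * B * r * L = ((h + b) * B) * (14 * (r * L)) by ring.
rewrite ler_pM2l ?mulr_gt0//.
have H1 : r * L' <= r * (2 * L) by rewrite ler_pM2l// (lt_le_trans _ r1).
have H2 : r * (1 / 2) <= r * L by rewrite ler_pM2l// (lt_le_trans _ r1).
rewrite mulrDr mulrCA; lra.
Qed.
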